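(* Let $(\Omega,\mathcal F,(\mathcal F_t)_{t\ge 0},Q)$ be a filtered probability space satisfying the usual conditions. Let $(M_t)_{t\ge0}$ and $(X_t)_{t\ge0}$ be two real-valued semimartingales, with $M_t$ strictly positive. Assume that $(M_t)$, $(M_tX_t)$ and $(M_tX_t^2)$ are local martingales. Then $X_t\equiv X_0$, i.e. almost surely $X_t=X_0$ for all $t\ge 0$.
   Context: Semimartingales and local martingales are taken with càdlàg paths and with respect to the filtration $(\mathcal F_t)$. No continuity of paths is assumed. *)

(* Defs.v *)
From HB Require Import structures.
From mathcomp Require Import all_boot all_order all_algebra.
From mathcomp Require Import all_classical all_reals all_analysis.
Import Order.TTheory GRing.Theory Num.Theory.
Import numFieldNormedType.Exports.

Set Implicit Arguments.
Unset Strict Implicit.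
Unset Printing Implicit Defensive.

Local Open Scope classical_set_scope.
Local Open Scope ring_scope.

(* Time is the half-line [0, +oo) of R: a family indexed by R (filtration or
   process) is only ever constrained at nonnegative times.  Path properties are
   required almost surely. *)
Section continuous_time_processes.
Context {d : measure_display} {Omega : measurableType d} {R : realType}.
Variables (Q : probability Omega R) (F : R -> set (set Omega)).
Implicit Types (X M L A : R -> Omega -> R) (Y Z : Omega -> R).
Implicit Types (G : set (set Omega)) (tau : Omega -> \bar R).

Definition filtration : Prop :=
  [/\ forall t, 0 <= t -> sigma_algebra setT (F t),
      forall t, 0 <= t -> F t `<=` measurable &
      forall s t, 0 <= s -> s <= t -> F s `<=` F t].

(* In a filtration, the first clause also makes the whole space complete, since
   [F 0] consists of measurable sets. *)
Definition usual_conditions : Prop :=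
  [/\ Q.-negligible `<=` F 0 &
      forall t, 0 <= t -> F t = \bigcap_(s in [set s | t < s]) F s].

Definition measurable_wrt G Y : Prop :=
  forall B : set R, measurable B -> G (Y @^-1` B).

Definition adapted X : Prop := forall t, 0 <= t -> measurable_wrt (F t) (X t).

(* [Z] is a version of the conditional expectation of [Y] given [G]. *)
Definition is_cond_expectation G Y Z : Prop :=
  [/\ measurable_wrt G Z,
      Q.-integrable setT (EFin \o Z) &
      forall B, G B ->
        (\int[Q]_(w in B) (Z w)%:E = \int[Q]_(w in B) (Y w)%:E)%E].

Definition martingale X : Prop :=
  [/\ adapted X,
      forall t, 0 <= t -> Q.-integrable setT (EFin \o X t) &
      forall s t, 0 <= s -> s <= t -> is_cond_expectation (F s) (X t) (X s)].

Definition cadlag (f : R -> R) : Prop :=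
  (forall t, 0 <= t -> f x @[x --> t^'+] --> f t) /\
  (forall t, 0 < t -> cvg (f x @[x --> t^'-])).

Definition cadlag_paths X : Prop := {ae Q, forall w, cadlag (X ^~ w)}.

Definition stopping_time tau : Prop :=
  (forall w, (0 <= tau w)%E) /\
  (forall t, 0 <= t -> F t [set w | (tau w <= t%:E)%E]).

Definition stopped X tau : R -> Omega -> R :=
  fun t w => X (fine (Order.min t%:E (tau w))) w.

Definition localizing_sequence (tau : nat -> Omega -> \bar R) : Prop :=
  [/\ forall n, stopping_time (tau n),
      {ae Q, forall w n, (tau n w <= tau n.+1 w)%E} &
      {ae Q, forall w, tau n w @[n --> \oo] --> +oo%E}].

(* Stopped processes are multiplied by the indicator of [tau n > 0], so that the
   initial value need not be integrable.  Requiring uniform integrability of the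
   stopped martingales would define the same class: replace [tau n] by
   [min (tau n) n]. *)
Definition local_martingale X : Prop :=
  [/\ adapted X, cadlag_paths X &
      exists2 tau : nat -> Omega -> \bar R, localizing_sequence tau &
        forall n, martingale
          (fun t w => \1_[set u | (0 < tau n u)%E] w * stopped X (tau n) t w)].

Definition finite_variation X : Prop :=
  [/\ adapted X, cadlag_paths X &
      {ae Q, forall w, forall t, 0 <= t -> bounded_variation 0 t (X ^~ w)}].

(* The initial value is not split off: it may be put in either summand.  The
   sum is adapted with cadlag paths because both summands are. *)
Definition semimartingale X : Prop :=
  exists L A, [/\ local_martingale L, finite_variation A &
    forall t, 0 <= t -> forall w, X t w = L t w + A t w].

End continuous_time_processes.

(* Main.v *)
Require Import Defs.
From HB Require Import structures.
From mathcomp Require Import all_boot all_order all_algebra.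
From mathcomp Require Import all_classical all_reals all_analysis.
From mathcomp Require Import measurable_realfun ring lra.
Import Order.TTheory GRing.Theory Num.Theory.
Import numFieldNormedType.Exports.
Local Open Scope classical_set_scope.
Local Open Scope ring_scope.

(** Why the theorem is true.  For a constant [a], the process [M (X - a)^2] is
    the combination [a^2 M - 2 a (M X) + M X^2] of three local martingales, and
    it is nonnegative.  If it is a supermartingale, then on an event [B] of
    [F 0] on which [X 0] stays within [delta] of [a],
      [E (M t (X t - a)^2; B) <= E (M 0 (X 0 - a)^2; B) <= delta^2 E (M 0; B)],
    and cutting the range of [X 0] into cells of width [delta -> 0] forces
    [M t (X t - X 0)^2 = 0], so [X t = X 0] because [M t > 0]
    ([increment_cell_le], [increment_set_null], [ae_no_increment]).  Only the
    times [0] and [t] are compared; right-continuity then passes from positive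
    rational [t] to all times at once ([right_continuous_constant]).

    The delicate point is the supermartingale inequality, because the three
    processes come with three unrelated localizing sequences and have to be
    stopped at the minimum [tau] of three stopping times, where nothing is
    bounded.  It is obtained from Fatou's lemma as follows.  The combination [N] of the three processes, each stopped at its
    own time, is a true martingale; it may be negative after [tau], but at time
    [min t tau] it is the square above, hence nonnegative.  Approximate [tau]
    from the right by times with finitely many values.  For such times the
    submartingale inequality for the positive part of [N + K] is a finite sum
    over cells ([sampled_pos_le]).  Right-continuity of the paths and Fatou's
    lemma pass to the limit ([stopped_pos_le]), giving
      [K P(B) + E (N t; B, t < tau) <= E ((N t + K)^+; B)].
    Subtracting [K P(B)] leaves [E (max (N t) (-K); B)] on the right, which
    tends to [E (N t; B) = E (N 0; B)] as [K -> oo] by dominated convergence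
    ([stopped_le]). *)

Set Implicit Arguments.
Unset Strict Implicit.
Unset Printing Implicit Defensive.

(** * Sub-sigma-algebras *)

Section sub_sigma_algebra.
Context {d : measure_display} {Omega : measurableType d} {R : realType}.
Variables (G : set (set Omega)) (sG : sigma_algebra setT G).

(** Measurability with respect to a sub-sigma-algebra [G] is ordinary
    measurability for the structure generated by [G]; this transfers the
    closure properties of measurable sets and functions. *)
Lemma measurable_gE : @measurable _ (g_sigma_algebraType G) = G.
Proof. exact: sigma_algebra_id. Qed.

Lemma sub_sigmaC A : G A -> G (~` A).
Proof. rewrite -measurable_gE; exact: measurableC. Qed.

Lemma sub_sigmaI A B : G A -> G B -> G (A `&` B).
Proof. rewrite -measurable_gE; exact: measurableI. Qed.

Lemma sub_sigmaU A B : G A -> G B -> G (A `|` B).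
Proof. rewrite -measurable_gE; exact: measurableU. Qed.

Lemma measurable_wrtP (Y : Omega -> R) :
  measurable_wrt G Y <-> measurable_fun setT (Y : g_sigma_algebraType G -> R).
Proof.
split=> mY.
  by move=> _ B mB; rewrite setTI measurable_gE; exact: mY.
move=> B mB; have := mY measurableT B mB.
by rewrite setTI measurable_gE.
Qed.

Lemma measurable_wrt_measurable (Y : Omega -> R) :
  G `<=` measurable -> measurable_wrt G Y -> measurable_fun setT Y.
Proof. by move=> sub mY _ B mB; rewrite setTI; exact/sub/mY. Qed.

End sub_sigma_algebra.

(** * Martingales *)

Section martingales.
Context {d : measure_display} {Omega : measurableType d} {R : realType}.
Variables (Q : probability Omega R) (F : R -> set (set Omega)).
Hypothesis HF : filtration F.

Lemma filtration_sigma_algebra t : 0 <= t -> sigma_algebra setT (F t).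
Proof. by case: HF => + _ _; exact. Qed.

Lemma filtration_measurable t A : 0 <= t -> F t A -> measurable A.
Proof. by case: HF => _ + _ t0; apply. Qed.

Lemma filtration_le s t A : 0 <= s -> s <= t -> F s A -> F t A.
Proof. by case: HF => _ _ + s0 st; apply. Qed.

Lemma martingale_measurable N t : martingale Q F N -> 0 <= t ->
  measurable_fun setT (N t).
Proof.
move=> [aN _ _] t0; apply: (measurable_wrt_measurable _ (aN t t0)).
by move=> A; exact: filtration_measurable.
Qed.

Lemma martingale_integrable N t B : martingale Q F N -> 0 <= t ->
  measurable B -> Q.-integrable B (EFin \o N t).
Proof. by move=> [_ iN _] t0 mB; exact: (integrableS measurableT mB _ (iN t t0)). Qed.

Lemma martingale_integral N s t B : martingale Q F N -> 0 <= s -> s <= t ->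
  F s B -> (\int[Q]_(w in B) (N s w)%:E = \int[Q]_(w in B) (N t w)%:E)%E.
Proof. by move=> [_ _ cN] s0 st FB; have [_ _] := cN s t s0 st; exact. Qed.

Lemma martingaleP N : adapted F N ->
  (forall t, 0 <= t -> Q.-integrable setT (EFin \o N t)) ->
  (forall s t B, 0 <= s -> s <= t -> F s B ->
    (\int[Q]_(w in B) (N s w)%:E = \int[Q]_(w in B) (N t w)%:E)%E) ->
  martingale Q F N.
Proof.
move=> aN iN eN; split=> // s t s0 st; split; [exact: aN|exact: iN|].
by move=> B FB; exact: eN.
Qed.

Lemma martingale_cst (c : R) : martingale Q F (fun _ _ => c).
Proof.
apply: martingaleP => //.
- move=> t t0; apply/measurable_wrtP; first exact: filtration_sigma_algebra.
  exact: measurable_cst.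
- by move=> t t0; exact: finite_measure_integrable_cst.
Qed.

Lemma martingaleD N1 N2 : martingale Q F N1 -> martingale Q F N2 ->
  martingale Q F (fun t w => N1 t w + N2 t w).
Proof.
move=> m1 m2; apply: martingaleP.
- move=> t t0; have [a1 _ _] := m1; have [a2 _ _] := m2.
  apply/measurable_wrtP; first exact: filtration_sigma_algebra.
  by apply: measurable_funD;
    apply/(measurable_wrtP (filtration_sigma_algebra t0)); [exact: a1|exact: a2].
- move=> t t0; apply: eq_integrable (integrableD measurableT
    (martingale_integrable m1 t0 measurableT) (martingale_integrable m2 t0 measurableT)) => //.
- move=> s t B s0 st FB; have t0 := le_trans s0 st.
  have mB := filtration_measurable s0 FB.
  have E r : 0 <= r -> (\int[Q]_(w in B) (N1 r w + N2 r w)%:E =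
      \int[Q]_(w in B) (N1 r w)%:E + \int[Q]_(w in B) (N2 r w)%:E)%E.
    by move=> r0; rewrite -integralD_EFin//; exact: martingale_integrable.
  by rewrite !E// (martingale_integral m1 s0 st FB) (martingale_integral m2 s0 st FB).
Qed.

Lemma martingaleZ a N : martingale Q F N -> martingale Q F (fun t w => a * N t w).
Proof.
move=> m; apply: martingaleP.
- move=> t t0; have [aN _ _] := m.
  apply/measurable_wrtP; first exact: filtration_sigma_algebra.
  apply: measurable_funM => //.
  by apply/(measurable_wrtP (filtration_sigma_algebra t0)); exact: aN.
- move=> t t0; apply: eq_integrable (integrableZl measurableT a
    (martingale_integrable m t0 measurableT)) => //.
- move=> s t B s0 st FB; have t0 := le_trans s0 st.
  have mB := filtration_measurable s0 FB.
  have E r : 0 <= r -> (\int[Q]_(w in B) (a * N r w)%:E =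
      a%:E * \int[Q]_(w in B) (N r w)%:E)%E.
    move=> r0; rewrite -(integralZl mB (martingale_integrable m r0 mB)).
    by apply: eq_integral.
  by rewrite !E// (martingale_integral m s0 st FB).
Qed.

(** The submartingale inequality for the positive part comes from testing the
    martingale property on the part of [B] where [N s >= 0], an event of [F s]. *)
Lemma martingale_pos_part_le N s t B : martingale Q F N -> 0 <= s -> s <= t ->
  F s B -> (\int[Q]_(w in B) (Num.max (N s w) 0)%:E <=
            \int[Q]_(w in B) (Num.max (N t w) 0)%:E)%E.
Proof.
move=> m s0 st FB; have t0 := le_trans s0 st.
have [aN _ _] := m.
have mB := filtration_measurable s0 FB.
have mpos r D : 0 <= r -> measurable D ->
    measurable_fun D (fun w => (Num.max (N r w) 0)%:E).
  move=> r0 mD; apply/measurable_EFinP; apply: (@measurable_funS _ _ _ _ setT) => //.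
  by apply: measurable_maxr => //; exact: martingale_measurable.
have pos0 r (w : Omega) : (0 <= (Num.max (N r w) 0)%:E)%E by rewrite lee_fin le_max lexx orbT.
pose A := B `&` [set w | 0 <= N s w].
have FA : F s A.
  apply: (sub_sigmaI (filtration_sigma_algebra s0)) => //.
  have -> : [set w | 0 <= N s w] = N s @^-1` `[0, +oo[%classic.
    by apply/seteqP; split=> w /=; rewrite in_itv /= andbT.
  by apply: aN.
have mA := filtration_measurable s0 FA.
have -> : (\int[Q]_(w in B) (Num.max (N s w) 0)%:E = \int[Q]_(w in A) (N s w)%:E)%E.
  rewrite /A integral_mkcondr; apply: eq_integral => w wB.
  rewrite patchE; case: ifPn => [|] /=; rewrite ?inE/= ?notin_setE/=.
    by move=> N0; rewrite max_l.
  by move=> /negP; rewrite -ltNge => N0; rewrite max_r// ltW.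
rewrite (martingale_integral m s0 st FA).
apply: (@le_trans _ _ (\int[Q]_(w in A) (Num.max (N t w) 0)%:E)%E).
  apply: le_integral => //; first exact: martingale_integrable.
    apply: (@le_integrable _ _ _ Q _ _ _ (EFin \o N t)) => //.
    + exact: mpos.
    + move=> w _; rewrite lee_fin ger0_norm ?le_max ?lexx ?orbT//.
      by rewrite ge_max ler_norm normr_ge0.
    + exact: martingale_integrable.
  by move=> w _; rewrite lee_fin le_max lexx.
by apply: ge0_subset_integral => //; [exact: mpos|exact: subIsetl].
Qed.

End martingales.

(** * Sampling at times with finitely many values *)

Section sampling.
Context {d : measure_display} {Omega : measurableType d} {R : realType}.
Variables (Q : probability Omega R) (F : R -> set (set Omega)).
Hypothesis HF : filtration F.
Variables (N : R -> Omega -> R) (tau : Omega -> \bar R).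

Let sF := filtration_sigma_algebra HF.

(** The value of [N] at the discretization of [tau] on the grid of step [h]: the
    least grid time that is at least [tau], truncated at [k h].  The recursion
    runs over the horizon [k h], and only the values with [tau > k h] move when
    the horizon is extended. *)
Fixpoint sampled (h : R) (k : nat) (w : Omega) : R :=
  if k is j.+1 then
    if (tau w <= (j%:R * h)%:E)%E then sampled h j w else N (j.+1%:R * h) w
  else N 0 w.

Lemma sampled_time h k w : 0 < h -> (0 <= tau w)%E ->
  exists2 r, sampled h k w = N r w &
    fine (Order.min (k%:R * h)%:E (tau w)) <= r <=
    fine (Order.min (k%:R * h)%:E (tau w)) + h.
Proof.
move=> h0 tau0; elim: k => [|k IH] /=.
  by exists 0 => //; rewrite mul0r min_l//= lexx add0r ltW.
case: ifPn => [tauk|].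
  have [r -> rP] := IH; exists r => //.
  rewrite min_r in rP => //; rewrite min_r//.
  by apply: (le_trans tauk); rewrite lee_fin ler_pM2r// ler_nat.
rewrite -ltNge => ktau; exists (k.+1%:R * h) => //.
have E : k.+1%:R * h = k%:R * h + h by rewrite -natr1 mulrDl mul1r.
case: (leP ((k.+1%:R * h)%:E) (tau w)) => tauk /=.
  by rewrite lexx lerDl ltW.
move: ktau tauk tau0; case: (tau w) => //= x; rewrite !lte_fin => kx xk _.
by rewrite (ltW xk) E lerD2r ltW.
Qed.

Lemma sampled_gt h k w : 0 < h -> ((k%:R * h)%:E < tau w)%E ->
  sampled h k w = N (k%:R * h) w.
Proof.
case: k => [|k] h0 ktau /=; first by rewrite mul0r.
rewrite leNgt ifF//; apply/negbTE; rewrite negbK; apply: le_lt_trans ktau.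
by rewrite lee_fin ler_pM2r// ler_nat.
Qed.

Hypothesis tau_stop : stopping_time F tau.
Hypothesis mN : martingale Q F N.

Lemma measurable_sampled h k : 0 <= h -> measurable_fun setT (sampled h k).
Proof.
move=> h0; elim: k => [|k IH] /=; first exact: (martingale_measurable HF mN).
apply: measurable_fun_ifT => //.
  apply: (measurable_fun_bool true); rewrite setTI.
  have kh : 0 <= k%:R * h by rewrite mulr_ge0.
  have -> : (fun w => (tau w <= (k%:R * h)%:E)%E) @^-1` [set true] =
    [set w | (tau w <= (k%:R * h)%:E)%E] by apply/seteqP; split.
  by apply: (filtration_measurable HF kh); exact: (tau_stop.2 _ kh).
by apply: (martingale_measurable HF mN); rewrite mulr_ge0.
Qed.

Let mpos_sampled h k D : 0 <= h -> measurable D ->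
  measurable_fun D (fun w => (Num.max (sampled h k w) 0)%:E).
Proof.
move=> h0 mD; apply/measurable_EFinP; apply: (@measurable_funS _ _ _ _ setT) => //.
by apply: measurable_maxr => //; exact: measurable_sampled.
Qed.

Let mpos_N t D : 0 <= t -> measurable D ->
  measurable_fun D (fun w => (Num.max (N t w) 0)%:E).
Proof.
move=> t0 mD; apply/measurable_EFinP; apply: (@measurable_funS _ _ _ _ setT) => //.
by apply: measurable_maxr => //; exact: (martingale_measurable HF mN).
Qed.

Let pos0 (x : R) : (0 <= (Num.max x 0)%:E)%E.
Proof. by rewrite lee_fin le_max lexx orbT. Qed.

Variables (B : set Omega) (FB : F 0 B).

(** Once [tau] has been passed, the sampled value is frozen while the value at the
    later time [t] dominates it in mean.  Extending the horizon from [k h] to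
    [(k + 1) h] adds the cell [k h < tau <= (k + 1) h], an event known at time
    [(k + 1) h], at which the sample is taken there. *)
Lemma sampled_pos_le_cell h k t : 0 < h -> k%:R * h <= t ->
  (\int[Q]_(w in B `&` [set w | (tau w <= (k%:R * h)%:E)%E])
     (Num.max (sampled h k w) 0)%:E <=
   \int[Q]_(w in B `&` [set w | (tau w <= (k%:R * h)%:E)%E])
     (Num.max (N t w) 0)%:E)%E.
Proof.
move=> h0; elim: k => [|k IH] kt /=.
  rewrite mul0r in kt *; apply: (martingale_pos_part_le HF mN) => //.
  by apply: (sub_sigmaI (sF (lexx 0))) => //; exact: tau_stop.2.
have kh0 : 0 <= k%:R * h by rewrite mulr_ge0// ltW.
have kh1 : 0 <= k.+1%:R * h by rewrite mulr_ge0// ltW.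
have lekk : k%:R * h <= k.+1%:R * h by rewrite ler_pM2r// ler_nat.
have t0 : 0 <= t := le_trans kh1 kt.
set A := B `&` [set w | (tau w <= (k%:R * h)%:E)%E] in IH *.
set A' := B `&` _.
have FBr r : 0 <= r -> F r B by move=> r0; exact: (filtration_le HF _ r0 FB).
have FA' : F (k.+1%:R * h) A'.
  by apply: (sub_sigmaI (sF kh1)); [exact: FBr|exact: tau_stop.2].
have FA : F (k%:R * h) A.
  by apply: (sub_sigmaI (sF kh0)); [exact: FBr|exact: tau_stop.2].
have FD : F (k.+1%:R * h) (A' `\` A).
  rewrite setDE; apply: (sub_sigmaI (sF kh1)) => //; apply: (sub_sigmaC (sF kh1)).
  exact: (filtration_le HF kh0 lekk FA).
have mA := filtration_measurable HF kh0 FA.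
have mD := filtration_measurable HF kh1 FD.
have AE : A' = A `|` (A' `\` A).
  rewrite setDUK// => w [Bw /= tk]; split => //=.
  by apply: (le_trans tk); rewrite lee_fin.
have dAD : [disjoint A & A' `\` A].
  by apply/disj_setPS; rewrite setDE setICA setICr setI0.
have mU : measurable (A `|` (A' `\` A)) by exact: measurableU.
rewrite AE; rewrite !ge0_integral_setU//; last 2 first.
- exact: mpos_N.
- exact: (@mpos_sampled _ k.+1 _ (ltW h0)).
apply: leeD.
  rewrite (eq_integral (fun w => (Num.max (sampled h k w) 0)%:E)).
    by apply: IH; exact: le_trans kt.
  by move=> w; rewrite inE => -[_ /= ->].
rewrite (eq_integral (fun w => (Num.max (N (k.+1%:R * h) w) 0)%:E)).
  by apply: (martingale_pos_part_le HF mN).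
move=> w; rewrite inE => -[[Bw _] /= nA]; rewrite ifF//.
by apply/negP => tk; apply: nA.
Qed.

Lemma sampled_pos_le h k : 0 < h ->
  (\int[Q]_(w in B) (Num.max (sampled h k w) 0)%:E <=
   \int[Q]_(w in B) (Num.max (N (k%:R * h) w) 0)%:E)%E.
Proof.
move=> h0; have kh0 : 0 <= k%:R * h by rewrite mulr_ge0// ltW.
set C := [set w | (tau w <= (k%:R * h)%:E)%E].
have mB := filtration_measurable HF (lexx 0) FB.
have mC : measurable C by apply: (filtration_measurable HF kh0); exact: tau_stop.2.
have mBC : measurable (B `&` C) by exact: measurableI.
have mBD : measurable (B `\` C) by exact: measurableD.
have BE : B = (B `&` C) `|` (B `\` C) by rewrite setUIDK.
have dB : [disjoint B `&` C & B `\` C].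
  by apply/disj_setPS; rewrite setDE setIACA setICr setI0.
rewrite BE !ge0_integral_setU//; last 2 first.
- by apply: mpos_N => //; exact: measurableU.
- by apply: mpos_sampled; [exact: ltW|exact: measurableU].
apply: leeD; first exact: sampled_pos_le_cell.
rewrite (eq_integral (fun w => (Num.max (N (k%:R * h) w) 0)%:E))//.
by move=> w; rewrite inE => -[_ /= /negP]; rewrite -ltNge => /(sampled_gt h0) ->.
Qed.

End sampling.

(** * Right-continuous functions *)

Section right_limits.
Context {R : realType}.
Implicit Types (f : R -> R) (m : R).

(** The filter at the right of [m] excludes [m] itself, but the sampling times may
    reach [m]; the value of [f] at [m] being the limit, both cases are covered. *)
Lemma cvg_at_right_seq f m (r : R^nat) : f x @[x --> m^'+] --> f m ->
  (forall k, m <= r k) -> r k @[k --> \oo] --> m -> f (r k) @[k --> \oo] --> f m.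
Proof.
move=> /cvgrPdist_lt fm mr /cvgrPdist_lt rm; apply/cvgrPdist_lt => e e0.
have := fm e e0; rewrite near_withinE => /nbhs_ballP[D /= D0 Dm].
near=> k.
have [->|rk] := eqVneq (r k) m; first by rewrite subrr normr0.
apply: Dm; last by rewrite lt_neqAle eq_sym rk mr.
rewrite /ball/=; near: k; exact: rm.
Unshelve. all: by end_near. Qed.

Lemma cvg_at_right_stopped f m (sigma : \bar R) : f x @[x --> m^'+] --> f m ->
  (m%:E <= sigma)%E -> f (fine (Order.min x%:E sigma)) @[x --> m^'+] --> f m.
Proof.
move=> /cvgrPdist_lt fm ms; apply/cvgrPdist_lt => e e0.
move: ms; rewrite le_eqVlt => /predU1P[<-|ms].
  rewrite near_withinE; near=> x => mx.
  by rewrite min_r/= ?subrr ?normr0// lee_fin ltW.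
have := fm e e0; rewrite !near_withinE => /nbhs_ballP[D /= D0 Dm].
apply/nbhs_ballP; exists D => //= x xD mx.
have [xs|xs] := leP x%:E sigma; first exact: Dm.
have sfin : sigma \is a fin_num.
  by rewrite fin_numElt (lt_trans _ ms) ?ltNyr// (lt_trans xs) ?ltry.
move: ms xs; rewrite -(fineK sfin) /= !lte_fin => ms xs; apply: Dm => //=.
move: xD; rewrite /ball/=; rewrite !ltr0_norm ?subr_lt0// => xD.
by apply: le_lt_trans xD; rewrite lerN2 lerD2l lerN2 ltW.
Unshelve. all: by end_near. Qed.

Lemma cvg_pos_part (u : R^nat) (l : R) : 0 <= l -> u k @[k --> \oo] --> l ->
  Num.max (u k) 0 @[k --> \oo] --> l.
Proof.
move=> l0 /cvgrPdist_lt ul; apply/cvgrPdist_lt => e e0; near=> k.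
apply: (@le_lt_trans _ _ `|l - u k|); last by near: k; exact: ul.
have [uk|uk] := leP 0 (u k); first by [].
by rewrite !ger0_norm; lra.
Unshelve. all: by end_near. Qed.

Lemma limn_einf_le (u : (\bar R)^nat) C : (forall n, (u n <= C)%E) ->
  (limn_einf u <= C)%E.
Proof.
move=> uC; rewrite limn_einf_lim; apply: lime_le; first exact: is_cvg_einfs.
by near=> n; apply: le_trans (uC n); apply: ereal_inf_lbound; exists n => /=.
Unshelve. all: by end_near. Qed.

Lemma positive_rationals_dense_right (t e : R) : 0 <= t -> 0 < e ->
  exists i j : nat, t < i.+1%:R / j.+1%:R < t + e.
Proof.
move=> t0 e0; exists (Num.truncn (t * (Num.truncn e^-1).+1%:R)), (Num.truncn e^-1).
set n : R := (Num.truncn e^-1).+1%:R.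
have n0 : 0 < n by [].
have en : e^-1 < n by exact: truncnS_gt.
have /andP[lo up] := truncn_itv (mulr_ge0 t0 (ltW n0)).
rewrite ltr_pdivlMr// up/= ltr_pdivrMr// mulrDl -natr1.
apply: ler_ltD => //.
by rewrite mulrC -ltr_pdivrMr// div1r.
Qed.

Lemma right_continuous_constant f :
  (forall t, 0 <= t -> f x @[x --> t^'+] --> f t) ->
  (forall i j : nat, f (i.+1%:R / j.+1%:R) = f 0) ->
  forall t, 0 <= t -> f t = f 0.
Proof.
move=> rcf fq t t0; apply/eqP; rewrite -subr_eq0 -normr_eq0.
apply/negP => /negP n0.
have {n0}n0 : 0 < `|f t - f 0| by rewrite lt_neqAle eq_sym n0 normr_ge0.
have /cvgrPdist_lt/(_ _ n0) := rcf t t0.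
rewrite near_withinE => /nbhs_ballP[e /= e0 He].
have [i [j /andP[tq qt]]] := positive_rationals_dense_right t0 e0.
have xball : `|t - i.+1%:R / j.+1%:R| < e.
  by rewrite ltr0_norm ?subr_lt0// opprB ltrBlDl.
by have := He _ xball tq; rewrite fq ltxx.
Qed.

End right_limits.

(** * Stopping at a general stopping time *)

Section stopped_fatou.
Context {d : measure_display} {Omega : measurableType d} {R : realType}.
Variables (Q : probability Omega R) (F : R -> set (set Omega)).
Hypothesis HF : filtration F.

Lemma measurable_stopping_gt tau t : stopping_time F tau -> 0 <= t ->
  measurable [set w | (t%:E < tau w)%E].
Proof.
move=> [_ st] t0; have -> : [set w | (t%:E < tau w)%E] = ~` [set w | (tau w <= t%:E)%E].
  by apply/seteqP; split => w /=; rewrite ltNge => /negP.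
by apply: measurableC; apply: (filtration_measurable HF t0); exact: st.
Qed.

(** Fatou's lemma needs a lower bound for the sampled values, which is why the
    positive part of [N + K] is used in place of [N].  The limit is taken only
    where its value is known to be measurable: on [t < tau] it is [N t + K],
    and on the rest of [B] it is bounded below by [K]. *)
Lemma stopped_pos_le N tau t B K : martingale Q F N -> stopping_time F tau ->
  0 < t -> F 0 B -> 0 <= K ->
  {ae Q, forall w, B w ->
    let m := fine (Order.min t%:E (tau w)) in
    N x w @[x --> m^'+] --> N m w /\ 0 <= N m w} ->
  (K%:E * Q B + \int[Q]_(w in B `&` [set w | (t%:E < tau w)%E])
     (Num.max (N t w) 0)%:E <=
   \int[Q]_(w in B) (Num.max (N t w + K) 0)%:E)%E.
Proof.
move=> mN st t0 FB K0 rcN.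
have t0' := ltW t0.
have mB := filtration_measurable HF (lexx 0) FB.
have mC := measurable_stopping_gt st t0'.
set C := [set w | _] in mC *.
pose N' s w := N s w + K.
have mN' : martingale Q F N' by apply: martingaleD => //; exact: martingale_cst.
(* the grid of step [t / (k + 1)] reaches [t] at its point of index [k + 1] *)
pose h k : R := t / k.+1%:R.
have h0 k : 0 < h k by rewrite divr_gt0.
have hk k : k.+1%:R * h k = t by rewrite /h mulrC divfK// pnatr_eq0.
pose f k w := (Num.max (sampled N' tau (h k) k.+1 w) 0)%:E.
have mf k : measurable_fun B (f k).
  apply/measurable_EFinP; apply: (@measurable_funS _ _ _ _ setT) => //.
  by apply: measurable_maxr => //; apply: (measurable_sampled HF st mN'); exact: ltW.
have f0 k w : (0 <= f k w)%E by rewrite lee_fin le_max lexx orbT.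
have mmax : measurable_fun setT (fun w => Num.max (N t w) 0).
  by apply: measurable_maxr => //; exact: (martingale_measurable HF mN).
pose g w := (K%:E + ((fun w => (Num.max (N t w) 0)%:E) \_ C) w)%E.
have g10 w : (0 <= ((fun w => (Num.max (N t w) 0)%:E) \_ C) w)%E.
  by rewrite patchE; case: ifP => // _; rewrite lee_fin le_max lexx orbT.
have mg1 : measurable_fun B ((fun w => (Num.max (N t w) 0)%:E) \_ C).
  apply: (@measurable_funS _ _ _ _ setT) => //.
  apply/(measurable_restrictT _ mC).
  by apply/measurable_EFinP; exact: (@measurable_funS _ _ _ _ setT).
apply: (@le_trans _ _ (\int[Q]_(w in B) g w)%E).
  rewrite ge0_integralD//.
  by rewrite integral_cst// -integral_mkcondr.
apply: (@le_trans _ _ (\int[Q]_(w in B) limn_einf (f ^~ w))%E).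
  apply: ae_ge0_le_integral => //.
  - by move=> w _; rewrite adde_ge0.
  - by apply: emeasurable_funD => //; exact: measurable_cst.
  - move=> w _; rewrite limn_einf_lim; apply: lime_ge;
      [exact: is_cvg_einfs|near=> n].
    by apply: le_ereal_inf_tmp => _ [k /= _ <-]; exact: f0.
  - apply: measurableT_comp => //; apply: measurable_fun_limn_esup => n.
    exact: measurableT_comp.
  apply: filterS rcN => w + Bw => /(_ Bw) /=; set m := fine _ => -[rc Nm].
  have tau0 := st.1 w.
  have fm : (f ^~ w) k @[k --> \oo] --> (N m w + K)%:E.
    have rex k : exists r, sampled N' tau (h k) k.+1 w = N' r w /\ m <= r <= m + h k.
      have [r rE] := @sampled_time _ _ _ N' tau (h k) k.+1 w (h0 k) tau0.
      by rewrite hk => rm; exists r.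
    have {rex}[r rE] := choice rex.
    have rm : r k @[k --> \oo] --> m.
      apply: (@squeeze_cvgr _ _ _ _ (fun=> m) (fun k => m + h k)).
      - by near=> k; exact: (rE k).2.
      - exact: cvg_cst.
      - rewrite -[X in _ --> X]addr0; apply: cvgD; first exact: cvg_cst.
        rewrite -(mulr0 t) /h; apply: cvgM; [exact: cvg_cst|exact: cvg_harmonic].
    have NE : (fun k => N' (r k) w) k @[k --> \oo] --> N m w + K.
      apply: cvgD; last exact: cvg_cst.
      by apply: (cvg_at_right_seq rc _ rm) => k; case/andP: (rE k).2.
    have -> : f^~ w = fun k => (Num.max (N' (r k) w) 0)%:E.
      by apply/funext => k; rewrite /f (rE k).1.
    apply: cvg_EFin; first by near=> k.
    by apply: cvg_pos_part => //; rewrite addr_ge0.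
  have -> : limn_einf (f^~ w) = (N m w + K)%:E by rewrite (cvg_limn_einf_sup fm).1.
  (* off [t < tau] the bound is [K], by nonnegativity of [N] at [min t tau] *)
  rewrite /g patchE; case: ifPn => [|_]; last by rewrite adde0 lee_fin lerDr.
  rewrite inE/= => tt; have mt : m = t by rewrite /m min_l//= ltW.
  by rewrite mt in Nm *; rewrite max_l// -EFinD lee_fin addrC.
apply: (le_trans (fatou Q mB mf _)); first by move=> *; exact: f0.
apply: limn_einf_le => k.
have := sampled_pos_le HF st mN' FB k.+1 (h0 k).
by rewrite hk.
Unshelve. all: by end_near. Qed.

(** A supermartingale-type inequality for a martingale which is nonnegative at
    time [min t tau], though possibly negative afterwards: letting [K] tend to
    infinity in [stopped_pos_le] removes the truncation at [- K]. *)
Lemma stopped_le N tau t B : martingale Q F N -> stopping_time F tau ->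
  0 < t -> F 0 B ->
  {ae Q, forall w, B w ->
    let m := fine (Order.min t%:E (tau w)) in
    N x w @[x --> m^'+] --> N m w /\ 0 <= N m w} ->
  (\int[Q]_(w in B `&` [set w | (t%:E < tau w)%E])
     (Num.max (N t w) 0)%:E <=
   \int[Q]_(w in B) (N 0 w)%:E)%E.
Proof.
move=> mN st t0 FB rcN.
have t0' := ltW t0.
have mB := filtration_measurable HF (lexx 0) FB.
have mNt : measurable_fun B (N t).
  by apply: (@measurable_funS _ _ _ _ setT) => //; exact: (martingale_measurable HF mN).
rewrite (martingale_integral mN (lexx 0) t0' FB).
have iN := martingale_integrable mN t0' mB.
pose f (k : nat) w := (Num.max (N t w) (- k%:R))%:E.
have mf k : measurable_fun B (f k).
  by apply/measurable_EFinP; apply: measurable_maxr => //; exact: measurable_cst.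
have fN k w : (`|f k w| <= `|(N t w)%:E|)%E.
  rewrite lee_fin /Num.max; case: ifP => // Nk.
  have k0 : 0 <= k%:R :> R by [].
  by rewrite normrN (ger0_norm k0) ltr0_norm; lra.
have fcvg w : f ^~ w k @[k --> \oo] --> (N t w)%:E.
  apply: cvg_near_cst; near=> k; rewrite /f max_l// lerNl.
  by near: k; apply: nbhs_infty_ger.
have mNtE : measurable_fun B (fun w => (N t w)%:E) by exact/measurable_EFinP.
have [_ _ lim_f] := dominated_convergence mB mf mNtE
  (aeW _ (fun w _ => fcvg w)) (integrable_abse iN) (aeW _ (fun w k _ => fN k w)).
apply: (@lee_cvg_to _ _ _ _ (fun=> _) _ _ _ (cvg_cst _) lim_f).
near=> k; rewrite /=.
have k0 : 0 <= k%:R :> R by [].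
have := stopped_pos_le mN st t0 FB k0 rcN.
set I := (X in (_ + X)%E).
have -> : (\int[Q]_(w in B) (Num.max (N t w + k%:R) 0)%:E =
   k%:R%:E * Q B + \int[Q]_(w in B) f k w)%E.
  rewrite -(integral_cst Q mB) -integralD//; first last.
  - apply: (le_integrable mB (mf k) (fun w _ => fN k w) iN).
  - exact: finite_measure_integrable_cst.
  apply: eq_integral => w _; rewrite /cst -EFinD; congr EFin.
  by rewrite /Num.max; do 2 case: ifPn => //; rewrite -?leNgt; lra.
by rewrite leeD2lE// fin_numM// fin_num_measure.
Unshelve. all: by end_near. Qed.

End stopped_fatou.

(** * The weighted square increment up to a common stopping time *)

Section localized_square.
Context {d : measure_display} {Omega : measurableType d} {R : realType}.
Variables (Q : probability Omega R) (F : R -> set (set Omega)).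
Hypothesis HF : filtration F.

Let sF := filtration_sigma_algebra HF.

Lemma stopping_time_min (s t : Omega -> \bar R) : stopping_time F s ->
  stopping_time F t -> stopping_time F (fun w => Order.min (s w) (t w)).
Proof.
move=> [s0 Fs] [t0 Ft]; split=> [w|r r0]; first by rewrite le_min s0 t0.
have -> : [set w | (Order.min (s w) (t w) <= r%:E)%E] =
    [set w | (s w <= r%:E)%E] `|` [set w | (t w <= r%:E)%E].
  apply/seteqP; split => w /=; rewrite ge_min; first by move=> /orP.
  by move=> ?; apply/orP.
by apply: (sub_sigmaU (sF r0)); [exact: Fs|exact: Ft].
Qed.

(** The process that has to be a martingale in the definition of a local one. *)
Definition localized (Y : R -> Omega -> R) (tau : Omega -> \bar R) :
    R -> Omega -> R :=
  fun t w => \1_[set u | (0 < tau u)%E] w * stopped Y tau t w.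

Lemma localizedE (Y : R -> Omega -> R) tau t w :
  (0 < tau w)%E -> (t%:E <= tau w)%E -> localized Y tau t w = Y t w.
Proof.
by move=> tau0 ttau; rewrite /localized /stopped indicE mem_set// mul1r min_l.
Qed.

Lemma cvg_localized (Y : R -> Omega -> R) tau w m :
  (0 < tau w)%E -> (m%:E <= tau w)%E ->
  Y x w @[x --> m^'+] --> Y m w -> localized Y tau x w @[x --> m^'+] --> Y m w.
Proof.
move=> tau0 mtau Ym; rewrite /localized /stopped indicE mem_set//.
under eq_fun do rewrite mul1r.
exact: (cvg_at_right_stopped (f := Y^~ w)).
Qed.

Variables (M X : R -> Omega -> R).
Let MX t w := M t w * X t w.
Let MX2 t w := M t w * X t w ^+ 2.

Variables (tau1 tau2 tau3 : Omega -> \bar R).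
Hypotheses (st1 : stopping_time F tau1) (st2 : stopping_time F tau2)
  (st3 : stopping_time F tau3).
Hypotheses (m1 : martingale Q F (localized M tau1))
  (m2 : martingale Q F (localized MX tau2))
  (m3 : martingale Q F (localized MX2 tau3)).
Hypotheses (cM : cadlag_paths Q M) (cMX : cadlag_paths Q MX)
  (cMX2 : cadlag_paths Q MX2).
Hypothesis Mpos : {ae Q, forall w, forall t, 0 <= t -> 0 < M t w}.

Let tau w := Order.min (tau1 w) (Order.min (tau2 w) (tau3 w)).

Let st : stopping_time F tau.
Proof. by do 2?apply: stopping_time_min. Qed.

(** [M (X - a)^2] is a quadratic polynomial in [X] weighted by [M].  Its three
    terms may be stopped at three different times, since up to the minimum [tau]
    these agree with the unstopped processes. *)
Lemma weighted_square_le (t a : R) B (C : R) : 0 < t -> F 0 B ->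
  (forall w, B w -> (0 < tau w)%E) -> 0 <= C ->
  (forall w, B w -> M 0 w * (X 0 w - a) ^+ 2 <= C) ->
  (\int[Q]_(w in B `&` [set w | (t%:E < tau w)%E])
     (Num.max (M t w * (X t w - a) ^+ 2) 0)%:E <= C%:E)%E.
Proof.
move=> t0 FB B0 C0 BC.
have mB := filtration_measurable HF (lexx 0) FB.
pose N s w := a ^+ 2 * localized M tau1 s w +
  ((-2 * a) * localized MX tau2 s w + localized MX2 tau3 s w).
have mN : martingale Q F N.
  apply: (martingaleD HF); first exact: (martingaleZ HF).
  by apply: (martingaleD HF) => //; exact: (martingaleZ HF).
have tauE w s : (s <= tau w)%E -> [/\ s <= tau1 w, s <= tau2 w & s <= tau3 w]%E.
  by rewrite /tau !le_min => /and3P.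
have tau0 w : (0 < tau w)%E -> [/\ 0 < tau1 w, 0 < tau2 w & 0 < tau3 w]%E.
  by rewrite /tau !lt_min => /and3P.
have sq s w : M s w * (X s w - a) ^+ 2 = a ^+ 2 * M s w + ((-2 * a) * MX s w + MX2 s w).
  by rewrite /MX /MX2; ring.
have NE s w : (0 < tau w)%E -> (s%:E <= tau w)%E -> N s w = M s w * (X s w - a) ^+ 2.
  by move=> /tau0[? ? ?] /tauE[? ? ?]; rewrite /N !localizedE.
rewrite (eq_integral (fun w => (Num.max (N t w) 0)%:E)); last first.
  move=> w; rewrite inE => -[Bw /= tw]; rewrite NE//; first exact: B0.
  exact: ltW.
apply: (le_trans (stopped_le HF mN st t0 FB _)).
  apply: filterS2 (filterI (filterI cM cMX) cMX2) Mpos.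
  move=> w [[[c1 _] [c2 _]] [c3 _]] Mw Bw /=; set m := fine _.
  have tauw := B0 w Bw.
  have mE : m%:E = Order.min t%:E (tau w).
    rewrite /m fineK// ge0_fin_numE; last by rewrite le_min lee_fin !ltW.
    by rewrite gt_min ltry.
  have mtau : (m%:E <= tau w)%E by rewrite mE ge_min lexx orbT.
  have m0 : 0 <= m by rewrite -lee_fin mE le_min lee_fin !ltW.
  have [? ? ?] := tau0 _ tauw; have [? ? ?] := tauE _ _ mtau.
  rewrite NE//; split; last by rewrite mulr_ge0 ?sqr_ge0// ltW// Mw.
  rewrite sq; apply: cvgD; first by apply: cvgMr; apply: cvg_localized => //; exact: c1.
  by apply: cvgD; [apply: cvgMr|]; apply: cvg_localized => //; [exact: c2|exact: c3].
apply: (@le_trans _ _ (\int[Q]_(w in B) (cst C%:E) w)%E).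
  apply: le_integral => //.
  - exact: (martingale_integrable mN).
  - exact: finite_measure_integrable_cst.
  - by move=> w /set_mem Bw; rewrite lee_fin NE ?BC ?B0// ltW// B0.
rewrite integral_cst// -[leRHS]mule1 lee_wpmul2l ?lee_fin//.
exact: probability_le1.
Qed.

Hypotheses (aM : adapted F M) (aX : adapted F X).

(** The event that [X] has moved by time [t < tau], made quantitative: [M t] and the
    increment are bounded below through [e], [M 0] is bounded, and [X 0] lies in
    a prescribed interval. *)
Let increment_set (t l e b b' : R) := [set w | [/\ (t%:E < tau w)%E, M 0 w <= l,
  b <= X 0 w < b', e <= M t w & 2 * e <= `|X t w - X 0 w|]].

Let adapted_measurable (Y : R -> Omega -> R) t : adapted F Y -> 0 <= t ->
  measurable_fun setT (Y t).
Proof.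
move=> aY t0; apply: (measurable_wrt_measurable _ (aY t t0)).
by move=> A; exact: (filtration_measurable HF t0).
Qed.

Let measurable_increment_set t l e b b' : 0 <= t ->
  measurable (increment_set t l e b b').
Proof.
move=> t0.
have pre (f : Omega -> R) (S : set R) : measurable_fun setT f -> measurable S ->
    measurable (f @^-1` S) by move=> mf mS; rewrite -[_ @^-1` _]setTI; exact: mf.
have -> : increment_set t l e b b' = [set w | (t%:E < tau w)%E] `&`
    (M 0 @^-1` `]-oo, l] `&` (X 0 @^-1` `[b, b'[ `&` (M t @^-1` `[e, +oo[ `&`
    (fun w => `|X t w - X 0 w|) @^-1` `[2 * e, +oo[))).
  apply/seteqP; split => w /=; rewrite !in_itv /= !andbT; first by case.
  by move=> [? [? [? [? ?]]]].
apply: measurableI; first exact: measurable_stopping_gt st t0.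
apply: measurableI; first by apply: pre => //; exact: adapted_measurable.
apply: measurableI; first by apply: pre => //; exact: adapted_measurable.
apply: measurableI; first by apply: pre => //; exact: adapted_measurable.
apply: pre => //; apply: measurableT_comp => //.
by apply: measurable_funB; exact: adapted_measurable.
Qed.

(** On the event, [X t] is at distance at least [2 e - delta >= e] from [a], so the
    weighted square is at least [e * e ^ 2]; at time [0] it is at most
    [l * delta ^ 2]. *)
Lemma increment_cell_le (t l e a delta : R) :
  0 < t -> 0 <= l -> 0 < delta -> delta <= e ->
  ((e ^+ 3)%:E * Q (increment_set t l e a (a + delta)) <= (l * delta ^+ 2)%:E)%E.
Proof.
move=> t0 l0 delta0 deltae; have t0' := ltW t0.
have e0 : 0 < e := lt_le_trans delta0 deltae.
pose B := ~` [set w | (tau w <= 0)%E] `&`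
  (M 0 @^-1` `]-oo, l] `&` X 0 @^-1` `[a, a + delta[).
have FB : F 0 B.
  apply: (sub_sigmaI (sF (lexx 0))).
    by apply: (sub_sigmaC (sF (lexx 0))); exact: st.2.
  by apply: (sub_sigmaI (sF (lexx 0))); [exact: aM|exact: aX].
have BP w : B w -> [/\ (0 < tau w)%E, M 0 w <= l & a <= X 0 w < a + delta].
  by rewrite /B /= !in_itv /= => -[/negP]; rewrite -ltNge => ? [? ?].
have mB := filtration_measurable HF (lexx 0) FB.
have mC := measurable_stopping_gt HF st t0'.
have mD := @measurable_increment_set t l e a (a + delta) t0'.
set D := increment_set _ _ _ _ _ in mD *.
have mBC : measurable (B `&` [set w | (t%:E < tau w)%E]) by exact: measurableI.
pose f w := (Num.max (M t w * (X t w - a) ^+ 2) 0)%:E.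
have mf S : measurable S -> measurable_fun S f.
  move=> mS; apply/measurable_EFinP; apply: (@measurable_funS _ _ _ _ setT) => //.
  apply: measurable_maxr => //; apply: measurable_funM; first exact: adapted_measurable.
  by apply: measurable_funX; apply: measurable_funB => //; exact: adapted_measurable.
have f0 w : (0 <= f w)%E by rewrite lee_fin le_max lexx orbT.
apply: (@le_trans _ _ (\int[Q]_(w in D) f w)%E).
  rewrite -integral_cst//; apply: ge0_le_integral => //; last 2 first.
  - exact: mf.
  - move=> w [_ _ /andP[aX0 X0a] eM eX]; rewrite lee_fin le_max; apply/orP; left.
    have eXa : e <= `|X t w - a|.
      have := ler_distD a (X t w) (X 0 w).
      by rewrite (distrC a) (@ger0_norm _ (X 0 w - a)) ?subr_ge0//; lra.
    rewrite exprS; apply: ler_pM => //; [exact: ltW|exact/sqr_ge0|].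
    by rewrite -(real_normK (num_real (X t w - a))) ler_pXn2r// nnegrE ltW.
  - by move=> w _; rewrite lee_fin exprn_ge0// ltW.
apply: (@le_trans _ _ (\int[Q]_(w in B `&` [set w | (t%:E < tau w)%E]) f w)%E).
  apply: ge0_subset_integral => //; first exact: mf.
  move=> w [tw Ml Xa _ _]; split => //; rewrite /B /= !in_itv/=; split=> //.
  by apply/negP; rewrite -ltNge (lt_trans _ tw)// lte_fin.
apply: weighted_square_le => //.
- by move=> w /BP[].
- by rewrite mulr_ge0// sqr_ge0.
- move=> w /BP[_ Ml /andP[aX0 X0a]].
  apply: (@le_trans _ _ (l * (X 0 w - a) ^+ 2)); first by rewrite ler_wpM2r// sqr_ge0.
  by rewrite ler_wpM2l//; apply: lerXn2r; rewrite ?nnegrE; lra.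
Qed.

(** The bound per cell is quadratic in the width [delta], while the number of cells
    needed to cover a bounded interval is only of order [1 / delta]. *)
Lemma increment_cells_le (t l e delta : R) k :
  0 < t -> 0 <= l -> 0 < delta -> delta <= e ->
  ((e ^+ 3)%:E * Q (increment_set t l e (- l) (- l + k%:R * delta)) <=
   (k%:R * (l * delta ^+ 2))%:E)%E.
Proof.
move=> t0 l0 delta0 deltae; have t0' := ltW t0.
have e0 : 0 < e := lt_le_trans delta0 deltae.
have e30 : (0 <= (e ^+ 3)%:E)%E by rewrite lee_fin exprn_ge0// ltW.
elim: k => [|k IH].
  rewrite !mul0r addr0 (_ : increment_set _ _ _ _ _ = set0) ?measure0 ?mule0//.
  by rewrite -subset0 => w [_ _ /andP[/le_lt_trans h /h]]; rewrite ltxx.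
rewrite -natr1 !mulrDl !mul1r EFinD.
have cell := increment_cell_le (- l + k%:R * delta) t0 l0 delta0 deltae.
apply: le_trans (leeD IH cell); rewrite -ge0_muleDr//.
apply: lee_wpmul2l => //.
apply: le_trans (measureU2 _ _ _); [|exact: measurable_increment_set..].
apply: le_measure; rewrite ?inE; [exact: measurable_increment_set| |].
  by apply: measurableU; exact: measurable_increment_set.
move=> w [? ? /andP[? ?] ? ?].
have [Xk|Xk] := ltP (X 0 w) (- l + k%:R * delta); [left|right]; split => //.
  by apply/andP; split.
by apply/andP; split => //; rewrite -addrA.
Qed.

Lemma increment_set_null (t l e : R) : 0 < t -> 0 < l -> 0 < e ->
  Q (increment_set t l e (- l) l) = 0%E.
Proof.
move=> t0 l0 e0; set D := increment_set _ _ _ _ _.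
have mD : measurable D by exact/measurable_increment_set/ltW.
have Qfin : Q D \is a fin_num by exact: fin_num_measure.
apply/eqP; rewrite eq_le measure_ge0 andbT -(fineK Qfin) lee_fin leNgt.
apply/negP => q0; set q := fine _ in q0.
have e30 : 0 < e ^+ 3 by rewrite exprn_gt0.
(* with [n] cells of width [2 l / n], the first bound makes the width at most [e]
   and the second makes the total [4 l ^ 3 / n] smaller than [e ^ 3 q] *)
pose x := Num.max (2 * l / e) (4 * l ^+ 3 / (e ^+ 3 * q)).
pose n : R := (Num.truncn x).+1%:R.
have xn : x < n by exact: truncnS_gt.
have n0 : 0 < n by [].
have /andP[xn1 xn2] : (2 * l / e < n) && (4 * l ^+ 3 / (e ^+ 3 * q) < n).
  by move: xn; rewrite gt_max.
pose delta := 2 * l / n.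
have delta0 : 0 < delta by rewrite divr_gt0// mulr_gt0.
have deltae : delta <= e.
  by rewrite /delta ler_pdivrMr//; move: xn1; rewrite ltr_pdivrMr//; lra.
have := increment_cells_le (Num.truncn x).+1 t0 (ltW l0) delta0 deltae.
have -> : - l + n * delta = l.
  by rewrite /delta mulrC divfK ?gt_eqF//; ring.
rewrite -/D -(fineK Qfin) -/q -EFinM lee_fin leNgt => /negP; apply.
have -> : n * (l * delta ^+ 2) = 4 * l ^+ 3 / n by rewrite /delta; field; rewrite gt_eqF.
rewrite ltr_pdivrMr//; move: xn2; rewrite ltr_pdivrMr ?mulr_gt0//; lra.
Qed.

(** A nonzero increment at time [t < tau] with [M t > 0] lies in one of countably
    many null events. *)
Lemma ae_no_increment (t : R) : 0 < t ->
  {ae Q, forall w, (t%:E < tau w)%E -> X t w = X 0 w}.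
Proof.
move=> t0.
have null : {ae Q, forall w, forall i j : nat,
    ~ increment_set t i.+1%:R j.+1%:R^-1 (- i.+1%:R) i.+1%:R w}.
  apply/ae_foralln => i; apply/ae_foralln => j.
  exists (increment_set t i.+1%:R j.+1%:R^-1 (- i.+1%:R) i.+1%:R); split.
  - exact/measurable_increment_set/ltW.
  - by apply: increment_set_null => //; rewrite invr_gt0.
  - by move=> w /contrapT.
apply: filterS2 null Mpos => w nullw Mw tw; apply/eqP; rewrite -subr_eq0 -normr_eq0.
apply/negP => /negP X0.
have {X0}X0 : 0 < `|X t w - X 0 w| by rewrite lt_neqAle eq_sym X0 normr_ge0.
have Mt := Mw t (ltW t0).
pose x := Num.max (M 0 w) `|X 0 w|.
pose y := Num.max (M t w)^-1 (2 / `|X t w - X 0 w|).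
apply: (nullw (Num.truncn x) (Num.truncn y)).
have := truncnS_gt x; rewrite gt_max => /andP[x1]; rewrite ltr_norml => /andP[x2 x3].
have := truncnS_gt y; rewrite gt_max => /andP[y1 y2].
split => //; first exact: ltW.
- by rewrite x3 ltW.
- by rewrite ltW// invf_plt// posrE.
- by rewrite ler_pdivrMr//; move: y2; rewrite ltr_pdivrMr//; lra.
Qed.

End localized_square.

(** * From fixed times to paths *)

Section conclusion.
Context {d : measure_display} {Omega : measurableType d} {R : realType}.
Variables (Q : probability Omega R) (F : R -> set (set Omega)).
Hypothesis HF : filtration F.

Lemma semimartingale_adapted (X : R -> Omega -> R) :
  semimartingale Q F X -> adapted F X.
Proof.
move=> [L [A [[aL _ _] [aA _ _] XE]]] t t0.
have -> : X t = L t \+ A t by apply/funext => w; exact: XE.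
have sFt := filtration_sigma_algebra HF t0.
by apply/(measurable_wrtP sFt); apply: measurable_funD;
  apply/(measurable_wrtP sFt); [exact: aL|exact: aA].
Qed.

Lemma semimartingale_right_continuous (X : R -> Omega -> R) :
  semimartingale Q F X ->
  {ae Q, forall w t, 0 <= t -> X x w @[x --> t^'+] --> X t w}.
Proof.
move=> [L [A [[_ cL _] [_ cA _] XE]]].
apply: filterS2 cL cA => w [rL _] [rA _] t t0.
rewrite XE//; apply: (cvg_trans _ (cvgD (rL t t0) (rA t t0))).
apply: near_eq_cvg; rewrite near_withinE; near=> x => tx /=.
by rewrite XE// (le_trans t0) ?ltW.
Unshelve. all: by end_near. Qed.

End conclusion.

Unset Implicit Arguments.

Theorem theorem2 (d : measure_display) (Omega : measurableType d) (R : realType)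
    (Q : probability Omega R) (F : R -> set (set Omega))
    (HF : filtration F) (HFusual : usual_conditions Q F)
    (M X : R -> Omega -> R)
    (HM : semimartingale Q F M) (HX : semimartingale Q F X)
    (Mpos : {ae Q, forall w, forall t, 0 <= t -> 0 < M t w})
    (HMloc : local_martingale Q F M)
    (HMXloc : local_martingale Q F (fun t w => M t w * X t w))
    (HMX2loc : local_martingale Q F (fun t w => M t w * X t w ^+ 2)) :
  {ae Q, forall w, forall t, 0 <= t -> X t w = X 0 w}.
Proof.
have aX := semimartingale_adapted HF HX.
have [aM cM [tau1 [st1 _ lim1] m1]] := HMloc.
have [_ cMX [tau2 [st2 _ lim2] m2]] := HMXloc.
have [_ cMX2 [tau3 [st3 _ lim3] m3]] := HMX2loc.
have Xt t : 0 < t -> {ae Q, forall w, X t w = X 0 w}.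
  move=> t0.
  have Xn : {ae Q, forall w n,
      (t%:E < Order.min (tau1 n w) (Order.min (tau2 n w) (tau3 n w)))%E ->
      X t w = X 0 w}.
    apply/ae_foralln => n.
    exact: (ae_no_increment HF (st1 n) (st2 n) (st3 n) (m1 n) (m2 n) (m3 n)).
  apply: filterS2 Xn (filterI (filterI lim1 lim2) lim3).
  move=> w Xw [[/cvgeyPgt/(_ t) l1 /cvgeyPgt/(_ t) l2] /cvgeyPgt/(_ t) l3].
  have [n _ tn] := filterI l1 (filterI l2 l3).
  by apply: (Xw n); rewrite !lt_min; apply/and3P; have [? [? ?]] := tn n (leqnn n).
have Xq : {ae Q, forall w (i j : nat), X (i.+1%:R / j.+1%:R) w = X 0 w}.
  by apply/ae_foralln => i; apply/ae_foralln => j; apply: Xt; rewrite divr_gt0.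
apply: filterS2 Xq (semimartingale_right_continuous HX) => w Xqw rcX.
exact: (right_continuous_constant (f := X^~ w)).
Qed.
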